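(* Let $\tau(x,y,t)$ be the polynomial \begin{align*} \tau(x,y,t) ={}& 198 x + \tfrac{3033}{2} x^2 t + \tfrac{6615}{2} x^2 t^2 + \tfrac{8883}{2} x t^2 + 1494 x t + 2592 y^2 x t^2 + x^6 + 6561 x t^3 \\ & + 306 x^2 y^2 + 576 y^4 t + 2970 y^2 t^2 + 3240 x^2 t^3 + 180 x^4 t + 96 x^3 y^2 + 1080 x^3 t^2 \\ & + 741 x^3 t + 2592 y^2 t^3 + 1710 t y^2 + 4860 t^4 x + 522 x y^2 + 192 x y^4 + 1458 x t^5 + 432 y^4 t^2 \\ & + 972 y^2 t^4 + 135 x^4 t^2 + 540 x^3 t^3 + 18 x^5 t + 1215 x^2 t^4 + 48 x^2 y^4 + 12 x^4 y^2 + 864 x^2 y^2 t \\ & + 144 x^3 t y^2 + 648 x^2 t^2 y^2 + 1908 x y^2 t + 1296 x y^2 t^3 + 288 x y^4 t + 729 t^6 + 64 y^6 + 405 y^2 \\ & + 2916 t^5 + 228 y^4 + 12 x^5 + 261 x^2 + 2142 t^2 + \tfrac{513}{8} + \tfrac{8667}{2} t^3 + \tfrac{345}{2} x^3 \\ & + \tfrac{1125}{2} t + \tfrac{249}{4} x^4 + \tfrac{19521}{4} t^4 . \end{align*} Then the KP1 solution $$u(x,y,t) = 2\,\frac{\partial^2}{\partial x^2} \ln\bigl(\tau(x,y,t)\bigr)$$ obtained from $\tau$ is real and regular for all real $(x,y,t)$. That is, the rational function $u$ is a solution of the KP1 equation $$(-4u_t + 6 u u_x + u_{xxx})_x - 3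 u_{yy} = 0,$$ and it takes real values and has no singularities at any $(x,y,t)\in\mathbb{R}^3$.
   Context: The KP1 equation is the Kadomtsev–Petviashvili equation for a function $u=u(x,y,t)$ in the form $(-4u_t + 6uu_x + u_{xxx})_x - 3u_{yy} = 0$, where subscripts denote partial derivatives. A polynomial $\tau(x,y,t)$ (a $\tau$-function, up to an exponential factor with exponent linear in $x$, which contributes nothing to $u$) gives rise to the rational function $u = 2\,\partial_x^2 \ln \tau = 2\,\dfrac{\tau\,\tau_{xx} - \tau_x^2}{\tau^2}$. Such a solution is called real if it takes only real values at real $(x,y,t)$, and regular if its denominator never vanishes at real $(x,y,t)$. *)

(* Defs.v *)
From Stdlib Require Import Reals.
From Coquelicot Require Import Coquelicot.
Open Scope R_scope.

(* Stdlib/Coquelicot reals.  Since a tau-polynomial may have complex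
   coefficients, KP1 solutions are complex-valued functions of the three real
   variables x, y, t; being real-valued is then an actual property. *)

(* The derivative of a curve in C is taken on real and imaginary parts.  Like
   Derive, it is only meaningful where the curve is differentiable. *)
Definition CDerive (f : R -> C) (s : R) : C :=
  (Derive (fun r => Re (f r)) s, Derive (fun r => Im (f r)) s).

Definition ex_CDerive (f : R -> C) (s : R) : Prop :=
  ex_derive (K := R_AbsRing) (V := C_R_NormedModule) f s.

Definition dx (f : R -> R -> R -> C) (x y t : R) : C :=
  CDerive (fun s => f s y t) x.
Definition dy (f : R -> R -> R -> C) (x y t : R) : C :=
  CDerive (fun s => f x s t) y.
Definition dt (f : R -> R -> R -> C) (x y t : R) : C :=
  CDerive (fun s => f x y s) t.

Definition has_dx (f : R -> R -> R -> C) : Prop :=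
  forall x y t : R, ex_CDerive (fun s => f s y t) x.
Definition has_dy (f : R -> R -> R -> C) : Prop :=
  forall x y t : R, ex_CDerive (fun s => f x s t) y.
Definition has_dt (f : R -> R -> R -> C) : Prop :=
  forall x y t : R, ex_CDerive (fun s => f x y s) t.

(* - 4 u_t + 6 u u_x + u_xxx *)
Definition KP1_inner (u : R -> R -> R -> C) (x y t : R) : C :=
  (- RtoC 4 * dt u x y t + RtoC 6 * u x y t * dx u x y t
   + dx (dx (dx u)) x y t)%C.

(* Classical solutions on the whole of R^3: every derivative occurring in
   (- 4 u_t + 6 u u_x + u_xxx)_x - 3 u_yy = 0 is required to exist. *)
Definition KP1_solution (u : R -> R -> R -> C) : Prop :=
  has_dt u /\
  has_dx u /\ has_dx (dx u) /\ has_dx (dx (dx u)) /\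
  has_dy u /\ has_dy (dy u) /\
  has_dx (KP1_inner u) /\
  forall x y t : R,
    (dx (KP1_inner u) x y t - RtoC 3 * dy (dy u) x y t)%C = RtoC 0.

(* u = 2 (ln tau)_xx = 2 (tau tau_xx - tau_x^2) / tau^2, in the second form,
   which needs no branch of the complex logarithm. *)
Definition KP1_num (tau : R -> R -> R -> C) (x y t : R) : C :=
  (RtoC 2 * (tau x y t * dx (dx tau) x y t
             - dx tau x y t * dx tau x y t))%C.
Definition KP1_den (tau : R -> R -> R -> C) (x y t : R) : C :=
  (tau x y t * tau x y t)%C.
Definition KP1_of_tau (tau : R -> R -> R -> C) (x y t : R) : C :=
  (KP1_num tau x y t / KP1_den tau x y t)%C.

Definition real_solution (u : R -> R -> R -> C) : Prop :=
  forall x y t : R, Im (u x y t) = 0.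

(* Division in C is total, so regularity is stated on the denominator. *)
Definition regular_tau (tau : R -> R -> R -> C) : Prop :=
  forall x y t : R, KP1_den tau x y t <> RtoC 0.

Definition tau (x y t : R) : R :=
  198 * x + 3033/2 * x^2 * t + 6615/2 * x^2 * t^2 + 8883/2 * x * t^2
  + 1494 * x * t + 2592 * y^2 * x * t^2 + x^6 + 6561 * x * t^3
  + 306 * x^2 * y^2 + 576 * y^4 * t + 2970 * y^2 * t^2 + 3240 * x^2 * t^3
  + 180 * x^4 * t + 96 * x^3 * y^2 + 1080 * x^3 * t^2 + 741 * x^3 * t
  + 2592 * y^2 * t^3 + 1710 * t * y^2 + 4860 * t^4 * x + 522 * x * y^2
  + 192 * x * y^4 + 1458 * x * t^5 + 432 * y^4 * t^2 + 972 * y^2 * t^4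
  + 135 * x^4 * t^2 + 540 * x^3 * t^3 + 18 * x^5 * t + 1215 * x^2 * t^4
  + 48 * x^2 * y^4 + 12 * x^4 * y^2 + 864 * x^2 * y^2 * t
  + 144 * x^3 * t * y^2 + 648 * x^2 * t^2 * y^2 + 1908 * x * y^2 * t
  + 1296 * x * y^2 * t^3 + 288 * x * y^4 * t + 729 * t^6 + 64 * y^6
  + 405 * y^2 + 2916 * t^5 + 228 * y^4 + 12 * x^5 + 261 * x^2 + 2142 * t^2
  + 513/8 + 8667/2 * t^3 + 345/2 * x^3 + 1125/2 * t + 249/4 * x^4
  + 19521/4 * t^4.

Definition tauC (x y t : R) : C := RtoC (tau x y t).

(* Main.v *)
Require Import Defs.
From Stdlib Require Import Reals Lra List FunctionalExtensionality.
From Coquelicot Require Import Coquelicot.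
Import ListNotations.
Open Scope R_scope.

(** Put X = x + 3 t + 2.  In the variables (X, y, t) the polynomial tau has
    only fifteen monomials and is quadratic in t.  Completing the square leaves
    a polynomial in X and y; with z = X + 2 i y the result reads
      tau = (3 t + 11/4 - Re (z^3))^2 + (Im (z^3))^2
            + 9/4 |z|^4 + 9 y^2 + 9/16,
    which is visibly positive ([tau_sum_of_squares]).  Hence the denominator
    tau^2 never vanishes, and u, a quotient of polynomials with real
    coefficients, is real.

    The equation itself comes from Hirota's bilinear identity
    (D_x^4 - 4 D_x D_t - 3 D_y^2) tau . tau = 0, an identity of polynomials
    that is verified by expansion ([tau_hirota]).  Divided by tau^2 and written
    for w = ln tau it says
      w_xxxx = 4 w_xt + 3 w_yy - 6 w_xx^2            ([log_xxxx_hirota]).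
    With u = 2 w_xx this gives u_xx = 8 w_xt + 6 w_yy - 3 u^2.  One more
    derivative in x turns - 4 u_t + 6 u u_x + u_xxx into 6 w_xyy, because
    u_t = 2 w_xxt.  The x-derivative of 6 w_xyy is 6 w_xxyy, which is 3 u_yy,
    and this is the KP1 equation ([KP1_solution_of_hirota]).

    Substituting the bilinear identity before differentiating keeps the
    derivatives of w at order four, while u_xxxx alone is of order six. *)

(** * Real functions seen as complex-valued ones *)

Definition complexify (g : R -> R -> R -> R) : R -> R -> R -> C :=
  fun x y t => RtoC (g x y t).

Definition is_dx (g g' : R -> R -> R -> R) : Prop :=
  forall x y t : R, is_derive (fun s => g s y t) x (g' x y t).
Definition is_dy (g g' : R -> R -> R -> R) : Prop :=
  forall x y t : R, is_derive (fun s => g x s t) y (g' x y t).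
Definition is_dt (g g' : R -> R -> R -> R) : Prop :=
  forall x y t : R, is_derive (fun s => g x y s) t (g' x y t).

Lemma CDerive_RtoC (f : R -> R) (s l : R) :
  is_derive f s l -> CDerive (fun r => RtoC (f r)) s = RtoC l.
Proof.
intros Hf; unfold CDerive; apply injective_projections; simpl.
- exact (is_derive_unique _ _ _ Hf).
- apply Derive_const.
Qed.

(** The product of [f] with the fixed vector 1 of C is differentiable because
    scalar multiplication is linear. *)
Lemma ex_CDerive_RtoC (f : R -> R) (s l : R) :
  is_derive f s l -> ex_CDerive (fun r => RtoC (f r)) s.
Proof.
intros Hf; exists (@scal R_AbsRing C_R_NormedModule l (RtoC 1)).
apply (is_derive_ext
  (fun r => @scal R_AbsRing C_R_NormedModule (f r) (RtoC 1))).
- intros r; apply injective_projections; simpl.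
  + apply Rmult_1_r.
  + apply Rmult_0_r.
- apply (is_derive_scal_l (K := R_AbsRing) (V := C_R_NormedModule) f s l).
  exact Hf.
Qed.

(** Stated as equalities of functions, so that they rewrite under the iterated
    operators [dx (dx _)] of the KP1 equation. *)
Lemma dx_complexify (g g' : R -> R -> R -> R) :
  is_dx g g' -> dx (complexify g) = complexify g'.
Proof.
intros H; do 3 (apply functional_extensionality; intro).
now apply CDerive_RtoC.
Qed.

Lemma dy_complexify (g g' : R -> R -> R -> R) :
  is_dy g g' -> dy (complexify g) = complexify g'.
Proof.
intros H; do 3 (apply functional_extensionality; intro).
now apply CDerive_RtoC.
Qed.

Lemma dt_complexify (g g' : R -> R -> R -> R) :
  is_dt g g' -> dt (complexify g) = complexify g'.
Proof.
intros H; do 3 (apply functional_extensionality; intro).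
now apply CDerive_RtoC.
Qed.

Lemma has_dx_complexify (g g' : R -> R -> R -> R) :
  is_dx g g' -> has_dx (complexify g).
Proof. intros H x y t; exact (ex_CDerive_RtoC _ _ _ (H x y t)). Qed.

Lemma has_dy_complexify (g g' : R -> R -> R -> R) :
  is_dy g g' -> has_dy (complexify g).
Proof. intros H x y t; exact (ex_CDerive_RtoC _ _ _ (H x y t)). Qed.

Lemma has_dt_complexify (g g' : R -> R -> R -> R) :
  is_dt g g' -> has_dt (complexify g).
Proof. intros H x y t; exact (ex_CDerive_RtoC _ _ _ (H x y t)). Qed.

(** * Differentiation of polynomial expressions *)

Lemma is_derive_Rplus (f g : R -> R) (x a b : R) :
  is_derive f x a -> is_derive g x b ->
  is_derive (fun s => f s + g s) x (a + b).
Proof. exact (is_derive_plus f g x a b). Qed.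

Lemma is_derive_Rminus (f g : R -> R) (x a b : R) :
  is_derive f x a -> is_derive g x b ->
  is_derive (fun s => f s - g s) x (a - b).
Proof. exact (is_derive_minus f g x a b). Qed.

Lemma is_derive_Rmult (f g : R -> R) (x a b : R) :
  is_derive f x a -> is_derive g x b ->
  is_derive (fun s => f s * g s) x (a * g x + f x * b).
Proof.
intros Hf Hg; apply (is_derive_mult f g x a b Hf Hg); exact Rmult_comm.
Qed.

Lemma is_derive_Rconst (c x : R) : is_derive (fun _ => c) x 0.
Proof. exact (is_derive_const c x). Qed.

Lemma is_derive_eq (f : R -> R) (x a b : R) :
  is_derive f x a -> a = b -> is_derive f x b.
Proof. now intros H <-. Qed.

(** Rules are selected by the syntax of the goal: letting unification try them
    in turn unfolds the operations of R at every failure.  [leaf]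
    differentiates the atoms; a leaf that matches on the goal starts with
    [idtac], which delays the match until an atom is reached. *)
Ltac derive_step leaf :=
  lazymatch goal with
  | |- is_derive (fun _ => ?c) _ _ => apply is_derive_Rconst
  | |- is_derive (fun s => @?f s + @?g s) ?x _ =>
      apply (is_derive_Rplus f g x)
  | |- is_derive (fun s => @?f s - @?g s) ?x _ =>
      apply (is_derive_Rminus f g x)
  | |- is_derive (fun s => @?f s * @?g s) ?x _ =>
      apply (is_derive_Rmult f g x)
  | |- _ => leaf
  end.

Tactic Notation "derive_poly" "using" tactic3(leaf) :=
  cbv zeta; eapply is_derive_eq; [ repeat derive_step leaf | cbv beta zeta ].

(** * From the bilinear equation to KP1 *)

(** [T i j] stands for the derivative of a function [T 0 0], i times in x and j
    times in y, and [V i j] for the t-derivative of [T i j].  Carrying all of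
    them as explicit functions makes mixed derivatives commute by
    construction. *)
Definition jets (T V : nat -> nat -> R -> R -> R -> R) : Prop :=
  (forall i j, is_dx (T i j) (T (S i) j)) /\
  (forall i j, is_dy (T i j) (T i (S j))) /\
  (forall i j, is_dt (T i j) (V i j)) /\
  (forall i j, is_dx (V i j) (V (S i) j)).

(** Half of (D_x^4 - 4 D_x D_t - 3 D_y^2) tau . tau, for tau = [T 0 0]. *)
Definition hirota_KP1 (T V : nat -> nat -> R -> R -> R -> R) (x y t : R) : R :=
  let T i j := T i j x y t in let V i j := V i j x y t in
  T 0%nat 0%nat * T 4%nat 0%nat - 4 * T 1%nat 0%nat * T 3%nat 0%nat
  + 3 * T 2%nat 0%nat ^ 2
  - 4 * (T 0%nat 0%nat * V 1%nat 0%nat - T 1%nat 0%nat * V 0%nat 0%nat)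
  - 3 * (T 0%nat 0%nat * T 0%nat 2%nat - T 0%nat 1%nat ^ 2).

Definition ratio (T S : nat -> nat -> R -> R -> R -> R) (i j : nat)
  (x y t : R) : R := S i j x y t / T 0%nat 0%nat x y t.

(** In this form the derivative of a ratio is a polynomial in ratios with the
    same denominator, so that differentiating the derivatives of a logarithm
    requires no further division. *)
Lemma is_derive_ratio (f g : R -> R) (x a b : R) :
  g x <> 0 -> is_derive f x a -> is_derive g x b ->
  is_derive (fun s => f s / g s) x (a / g x - f x / g x * (b / g x)).
Proof.
intros Hg Hf Hdg.
eapply is_derive_eq.
- exact (is_derive_div f g x a b Hf Hdg Hg).
- field; exact Hg.
Qed.

(** The derivatives of ln tau in terms of the ratios T_ij / tau: they are the
    joint cumulants whose moments are these ratios.  Unlike ln, the formulas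
    make sense wherever tau does not vanish. *)
Definition log_xx (T : nat -> nat -> R -> R -> R -> R) x y t :=
  let p i j := ratio T T i j x y t in
  p 2%nat 0%nat - p 1%nat 0%nat * p 1%nat 0%nat.
Definition log_xxx (T : nat -> nat -> R -> R -> R -> R) x y t :=
  let p i j := ratio T T i j x y t in
  p 3%nat 0%nat - 3 * p 1%nat 0%nat * p 2%nat 0%nat
  + 2 * p 1%nat 0%nat * p 1%nat 0%nat * p 1%nat 0%nat.
Definition log_xxxx (T : nat -> nat -> R -> R -> R -> R) x y t :=
  let p i j := ratio T T i j x y t in
  p 4%nat 0%nat - 4 * p 1%nat 0%nat * p 3%nat 0%nat
  - 3 * p 2%nat 0%nat * p 2%nat 0%nat
  + 12 * p 1%nat 0%nat * p 1%nat 0%nat * p 2%nat 0%nat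
  - 6 * p 1%nat 0%nat * p 1%nat 0%nat * p 1%nat 0%nat * p 1%nat 0%nat.
Definition log_yy (T : nat -> nat -> R -> R -> R -> R) x y t :=
  let p i j := ratio T T i j x y t in
  p 0%nat 2%nat - p 0%nat 1%nat * p 0%nat 1%nat.
Definition log_xyy (T : nat -> nat -> R -> R -> R -> R) x y t :=
  let p i j := ratio T T i j x y t in
  p 1%nat 2%nat - p 1%nat 0%nat * p 0%nat 2%nat
  - 2 * p 0%nat 1%nat * p 1%nat 1%nat
  + 2 * p 1%nat 0%nat * p 0%nat 1%nat * p 0%nat 1%nat.
Definition log_xxy (T : nat -> nat -> R -> R -> R -> R) x y t :=
  let p i j := ratio T T i j x y t in
  p 2%nat 1%nat - p 2%nat 0%nat * p 0%nat 1%nat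
  - 2 * p 1%nat 0%nat * p 1%nat 1%nat
  + 2 * p 1%nat 0%nat * p 1%nat 0%nat * p 0%nat 1%nat.
Definition log_xxyy (T : nat -> nat -> R -> R -> R -> R) x y t :=
  let p i j := ratio T T i j x y t in
  p 2%nat 2%nat - 2 * p 1%nat 0%nat * p 1%nat 2%nat
  - 2 * p 0%nat 1%nat * p 2%nat 1%nat - p 2%nat 0%nat * p 0%nat 2%nat
  - 2 * p 1%nat 1%nat * p 1%nat 1%nat
  + 2 * p 1%nat 0%nat * p 1%nat 0%nat * p 0%nat 2%nat
  + 2 * p 2%nat 0%nat * p 0%nat 1%nat * p 0%nat 1%nat
  + 8 * p 1%nat 0%nat * p 0%nat 1%nat * p 1%nat 1%nat
  - 6 * p 1%nat 0%nat * p 1%nat 0%nat * p 0%nat 1%nat * p 0%nat 1%nat.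
Definition log_xt (T V : nat -> nat -> R -> R -> R -> R) x y t :=
  let p i j := ratio T T i j x y t in let q i j := ratio T V i j x y t in
  q 1%nat 0%nat - p 1%nat 0%nat * q 0%nat 0%nat.
Definition log_xxt (T V : nat -> nat -> R -> R -> R -> R) x y t :=
  let p i j := ratio T T i j x y t in let q i j := ratio T V i j x y t in
  q 2%nat 0%nat - p 2%nat 0%nat * q 0%nat 0%nat
  - 2 * p 1%nat 0%nat * q 1%nat 0%nat
  + 2 * p 1%nat 0%nat * p 1%nat 0%nat * q 0%nat 0%nat.

(** [log_xxyy] and [log_xxt] each occur twice: this is the equality of mixed
    derivatives of ln tau on which the derivation of KP1 rests. *)
Lemma log_derivatives (T V : nat -> nat -> R -> R -> R -> R) :
  jets T V -> (forall x y t, T 0%nat 0%nat x y t <> 0) ->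
  (is_dx (log_xx T) (log_xxx T) /\ is_dx (log_xxx T) (log_xxxx T)) /\
  (is_dx (log_yy T) (log_xyy T) /\ is_dx (log_xyy T) (log_xxyy T)) /\
  (is_dy (log_xx T) (log_xxy T) /\ is_dy (log_xxy T) (log_xxyy T)) /\
  (is_dt (log_xx T) (log_xxt T V) /\ is_dx (log_xt T V) (log_xxt T V)).
Proof.
intros (HTx & HTy & HTt & HVx) HT.
assert (Hx : forall U, (forall i j, is_dx (U i j) (U (S i) j)) ->
  forall i j x y t, is_derive (fun s => ratio T U i j s y t) x
    (ratio T U (S i) j x y t - ratio T U i j x y t * ratio T T 1 0 x y t)).
{ intros U HU i j x y t; apply (is_derive_ratio (fun s => U i j s y t)
    (fun s => T 0%nat 0%nat s y t)); [apply HT | apply HU | apply HTx]. }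
assert (Hy : forall i j x y t, is_derive (fun s => ratio T T i j x s t) y
    (ratio T T i (S j) x y t - ratio T T i j x y t * ratio T T 0 1 x y t)).
{ intros i j x y t; apply (is_derive_ratio (fun s => T i j x s t)
    (fun s => T 0%nat 0%nat x s t)); [apply HT | apply HTy | apply HTy]. }
assert (Ht : forall i j x y t, is_derive (fun s => ratio T T i j x y s) t
    (ratio T V i j x y t - ratio T T i j x y t * ratio T V 0 0 x y t)).
{ intros i j x y t; apply (is_derive_ratio (fun s => T i j x y s)
    (fun s => T 0%nat 0%nat x y s)); [apply HT | apply HTt | apply HTt]. }
repeat apply conj; intros x y t.
- unfold log_xx; derive_poly using (apply Hx; assumption);
  unfold log_xxx; ring.
- unfold log_xxx; derive_poly using (apply Hx; assumption);
  unfold log_xxxx; ring.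
- unfold log_yy; derive_poly using (apply Hx; assumption);
  unfold log_xyy; ring.
- unfold log_xyy; derive_poly using (apply Hx; assumption);
  unfold log_xxyy; ring.
- unfold log_xx; derive_poly using (apply Hy; assumption);
  unfold log_xxy; ring.
- unfold log_xxy; derive_poly using (apply Hy; assumption);
  unfold log_xxyy; ring.
- unfold log_xx; derive_poly using (apply Ht; assumption);
  unfold log_xxt; ring.
- unfold log_xt; derive_poly using (apply Hx; assumption);
  unfold log_xxt; ring.
Qed.

(** The difference of the two sides is the bilinear form divided by the square
    of tau. *)
Lemma log_xxxx_hirota (T V : nat -> nat -> R -> R -> R -> R) (x y t : R) :
  T 0%nat 0%nat x y t <> 0 -> hirota_KP1 T V x y t = 0 ->
  log_xxxx T x y t
  = 4 * log_xt T V x y t + 3 * log_yy T x y t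
    - 6 * log_xx T x y t * log_xx T x y t.
Proof.
intros HT HH; apply Rminus_diag_uniq.
transitivity (hirota_KP1 T V x y t / T 0%nat 0%nat x y t ^ 2).
- unfold log_xxxx, log_xt, log_yy, log_xx, ratio, hirota_KP1; field; exact HT.
- rewrite HH; unfold Rdiv; apply Rmult_0_l.
Qed.

Lemma is_dx_scale (c : R) (g g' : R -> R -> R -> R) :
  is_dx g g' -> is_dx (fun x y t => c * g x y t) (fun x y t => c * g' x y t).
Proof. intros H x y t; exact (is_derive_scal _ x c _ (H x y t)). Qed.

Lemma is_dy_scale (c : R) (g g' : R -> R -> R -> R) :
  is_dy g g' -> is_dy (fun x y t => c * g x y t) (fun x y t => c * g' x y t).
Proof. intros H x y t; exact (is_derive_scal _ y c _ (H x y t)). Qed.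

Lemma is_dt_scale (c : R) (g g' : R -> R -> R -> R) :
  is_dt g g' -> is_dt (fun x y t => c * g x y t) (fun x y t => c * g' x y t).
Proof. intros H x y t; exact (is_derive_scal _ t c _ (H x y t)). Qed.

Lemma second_derivative_ln (f f' : R -> R) (l x : R) :
  (forall s, 0 < f s) -> (forall s, is_derive f s (f' s)) ->
  is_derive f' x l ->
  ex_derive_n (fun s => ln (f s)) 2 x /\
  Derive_n (fun s => ln (f s)) 2 x = l / f x - f' x / f x * (f' x / f x).
Proof.
intros Hpos Hf Hf'.
assert (H1 : forall s, Derive (fun s => ln (f s)) s = f' s / f s).
{ intros s; apply is_derive_unique.
  apply (is_derive_comp ln f s (/ f s) (f' s)); [| apply Hf].
  apply is_derive_ln, Hpos. }
assert (H2 : is_derive (Derive (fun s => ln (f s))) x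
               (l / f x - f' x / f x * (f' x / f x))).
{ apply (is_derive_ext (fun s => f' s / f s)); [now intros s; rewrite H1 |].
  apply is_derive_ratio; [apply Rgt_not_eq, Hpos | exact Hf' | apply Hf]. }
split; [eexists; exact H2 | exact (is_derive_unique _ _ _ H2)].
Qed.

Lemma KP1_of_tau_complexify (T V : nat -> nat -> R -> R -> R -> R) :
  jets T V -> (forall x y t, T 0%nat 0%nat x y t <> 0) ->
  KP1_of_tau (complexify (T 0%nat 0%nat))
  = complexify (fun x y t => 2 * log_xx T x y t).
Proof.
intros (HTx & _) HT; do 3 (apply functional_extensionality; intro).
unfold KP1_of_tau, KP1_num, KP1_den.
rewrite (dx_complexify _ _ (HTx 0%nat 0%nat)).
rewrite (dx_complexify _ _ (HTx 1%nat 0%nat)).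
unfold complexify, log_xx, ratio.
rewrite <- !RtoC_mult, <- RtoC_minus, <- RtoC_mult, <- RtoC_div.
- f_equal; field; apply HT.
- apply Rmult_integral_contrapositive; split; apply HT.
Qed.

(** With w = ln tau, replacing w_xxxx by its value from [log_xxxx_hirota] makes
    the inner expression - 4 u_t + 6 u u_x + u_xxx collapse to 6 w_xyy. *)
Lemma KP1_solution_of_hirota (T V : nat -> nat -> R -> R -> R -> R) :
  jets T V -> (forall x y t, T 0%nat 0%nat x y t <> 0) ->
  (forall x y t, hirota_KP1 T V x y t = 0) ->
  KP1_solution (KP1_of_tau (complexify (T 0%nat 0%nat))).
Proof.
intros HJ HT HH; rewrite (KP1_of_tau_complexify T V HJ HT).
destruct (log_derivatives T V HJ HT)
  as ((Hxx & Hxxx) & (Hyy & Hxyy) & (Hxxy & Hxxyy) & (Hxxt & Hxt)).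
set (u := fun x y t => 2 * log_xx T x y t).
assert (Du : is_dx u (fun x y t => 2 * log_xxx T x y t))
  by now apply is_dx_scale.
assert (Du2 : is_dx (fun x y t => 2 * log_xxx T x y t)
                    (fun x y t => 2 * log_xxxx T x y t))
  by now apply is_dx_scale.
assert (Du3 : is_dx (fun x y t => 2 * log_xxxx T x y t)
   (fun x y t => 8 * log_xxt T V x y t + 6 * log_xyy T x y t
                 - 24 * log_xx T x y t * log_xxx T x y t)).
{ intros x y t.
  apply (is_derive_ext (fun s => 2 * (4 * log_xt T V s y t
    + 3 * log_yy T s y t - 6 * log_xx T s y t * log_xx T s y t))).
  { intros s; f_equal; symmetry; apply log_xxxx_hirota; [apply HT | apply HH]. }
  derive_poly using (idtac; lazymatch goal with
    | |- is_derive (fun s => log_xt _ _ _ _ _) _ _ => apply Hxt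
    | |- is_derive (fun s => log_yy _ _ _ _) _ _ => apply Hyy
    | |- _ => apply Hxx
    end); ring. }
assert (Dt : is_dt u (fun x y t => 2 * log_xxt T V x y t))
  by now apply is_dt_scale.
assert (Dy : is_dy u (fun x y t => 2 * log_xxy T x y t))
  by now apply is_dy_scale.
assert (Dy2 : is_dy (fun x y t => 2 * log_xxy T x y t)
                    (fun x y t => 2 * log_xxyy T x y t))
  by now apply is_dy_scale.
assert (Din : is_dx (fun x y t => 6 * log_xyy T x y t)
                    (fun x y t => 6 * log_xxyy T x y t))
  by now apply is_dx_scale.
assert (Hinner : KP1_inner (complexify u)
                 = complexify (fun x y t => 6 * log_xyy T x y t)).
{ unfold KP1_inner.
  rewrite (dt_complexify _ _ Dt), (dx_complexify _ _ Du),
    (dx_complexify _ _ Du2), (dx_complexify _ _ Du3).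
  do 3 (apply functional_extensionality; intro).
  unfold complexify, u.
  rewrite <- RtoC_opp, <- !RtoC_mult, <- !RtoC_plus; f_equal; ring. }
unfold KP1_solution; rewrite Hinner.
rewrite (dx_complexify _ _ Du), (dx_complexify _ _ Du2),
  (dy_complexify _ _ Dy), (dy_complexify _ _ Dy2), (dx_complexify _ _ Din).
repeat apply conj; eauto using has_dx_complexify, has_dy_complexify,
  has_dt_complexify.
intros x y t; unfold complexify.
rewrite <- RtoC_mult, <- RtoC_minus; f_equal; ring.
Qed.

(** * Derivatives of explicit polynomials *)

(** The i-th derivative of the n-th power.  The recursion is on i, so that
    i = 0 reduces to a power for an arbitrary n. *)
Fixpoint pow_deriv (n i : nat) (x : R) {struct i} : R :=
  match i, n with
  | O, _ => x ^ n
  | S _, O => 0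
  | S i', S n' => INR (S n') * pow_deriv n' i' x
  end.

Lemma is_derive_pow_deriv (n i : nat) (x : R) :
  is_derive (pow_deriv n i) x (pow_deriv n (S i) x).
Proof.
revert n; induction i as [|i IH]; intros [|n].
- apply is_derive_Rconst.
- apply (is_derive_eq _ _ _ _ (is_derive_pow (fun s => s) (S n) x 1
    (is_derive_id x))); cbn [pow_deriv Init.Nat.pred]; ring.
- apply is_derive_Rconst.
- exact (is_derive_scal (pow_deriv n i) x (INR (S n)) _ (IH n)).
Qed.

Record monomial :=
  Monomial { coef : R; deg_x : nat; deg_y : nat; deg_t : nat }.

(** The mixed derivative of orders i, j, k of the polynomial with monomials
    [l]; it factors on each monomial, so no commutation has to be shown. *)
Fixpoint poly_jet (l : list monomial) (i j k : nat) (x y t : R) : R :=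
  match l with
  | nil => 0
  | m :: l' =>
      coef m * (pow_deriv (deg_x m) i x * pow_deriv (deg_y m) j y
                * pow_deriv (deg_t m) k t)
      + poly_jet l' i j k x y t
  end.

Lemma poly_jet_dx l i j k : is_dx (poly_jet l i j k) (poly_jet l (S i) j k).
Proof.
intros x y t; induction l as [|m l IH]; [exact (is_derive_Rconst 0 _) |].
cbn [poly_jet].
derive_poly using (idtac; lazymatch goal with
  | |- is_derive (fun s => poly_jet _ _ _ _ _ _ _) _ _ => exact IH
  | |- _ => apply is_derive_pow_deriv
  end); ring.
Qed.

Lemma poly_jet_dy l i j k : is_dy (poly_jet l i j k) (poly_jet l i (S j) k).
Proof.
intros x y t; induction l as [|m l IH]; [exact (is_derive_Rconst 0 _) |].
cbn [poly_jet].
derive_poly using (idtac; lazymatch goal with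
  | |- is_derive (fun s => poly_jet _ _ _ _ _ _ _) _ _ => exact IH
  | |- _ => apply is_derive_pow_deriv
  end); ring.
Qed.

Definition comoving (v c : R) (P : R -> R -> R -> R) (x y t : R) : R :=
  P (x + v * t + c) y t.

Lemma is_derive_Rcomp (f g : R -> R) (s v l : R) :
  is_derive f (g s) l -> is_derive g s v ->
  is_derive (fun r => f (g r)) s (v * l).
Proof. exact (is_derive_comp f g s l v). Qed.

(** The chain rule along (x + v t + c, y, t) for partial derivatives is proved
    monomial by monomial, where it reduces to the product rule. *)
Lemma poly_jet_dt_comoving (v c : R) (l : list monomial) (i j : nat) :
  is_dt (comoving v c (poly_jet l i j 0))
    (comoving v c (fun X y t => v * poly_jet l (S i) j 0 X y t
                            + poly_jet l i j 1 X y t)).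
Proof.
intros x y t; unfold comoving; induction l as [|m l IH].
- apply (is_derive_eq _ _ 0); [exact (is_derive_Rconst 0 t) | simpl; ring].
- assert (Hc : is_derive (fun s => pow_deriv (deg_x m) i (x + v * s + c)) t
                 (v * pow_deriv (deg_x m) (S i) (x + v * t + c))).
  { apply is_derive_Rcomp; [apply is_derive_pow_deriv |].
    auto_derive; [exact I | ring]. }
  cbn [poly_jet].
  derive_poly using (idtac; lazymatch goal with
    | |- is_derive (fun s => pow_deriv (deg_x m) _ _) _ _ => exact Hc
    | |- is_derive (fun s => pow_deriv _ _ s) _ _ => apply is_derive_pow_deriv
    | |- _ => exact IH
    end); ring.
Qed.

Lemma is_dx_comoving (v c : R) (P P' : R -> R -> R -> R) :
  is_dx P P' -> is_dx (comoving v c P) (comoving v c P').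
Proof.
intros H x y t; unfold comoving.
eapply is_derive_eq.
- apply (is_derive_Rcomp (fun X => P X y t) (fun s => s + v * t + c) x 1).
  + apply H.
  + auto_derive; [exact I | ring].
- apply Rmult_1_l.
Qed.

Lemma jets_comoving (v c : R) (l : list monomial) :
  jets (fun i j => comoving v c (poly_jet l i j 0))
       (fun i j => comoving v c (fun X y t => v * poly_jet l (S i) j 0 X y t
                                          + poly_jet l i j 1 X y t)).
Proof.
repeat apply conj; intros i j.
- apply is_dx_comoving, poly_jet_dx.
- intros x y t; apply poly_jet_dy.
- apply poly_jet_dt_comoving.
- apply is_dx_comoving; intros x y t.
  apply is_derive_Rplus; [apply is_derive_scal |]; apply poly_jet_dx.
Qed.

(** * The polynomial tau *)

(** tau in the variables (X, y, t) with X = x + 3 t + 2.  The leading part of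
    tau is ((x + 3 t)^2 + 4 y^2)^3, whence the speed 3; the shift by 2 removes the
    monomial X^5. *)
Definition tau_monomials : list monomial :=
  [Monomial 1 6 0 0; Monomial 12 4 2 0; Monomial 48 2 4 0; Monomial 64 0 6 0;
   Monomial (9/4) 4 0 0; Monomial 18 2 2 0; Monomial 36 0 4 0;
   Monomial (-11/2) 3 0 0; Monomial 66 1 2 0; Monomial 9 0 2 0;
   Monomial (65/8) 0 0 0;
   Monomial (-6) 3 0 1; Monomial 72 1 2 1; Monomial (33/2) 0 0 1;
   Monomial 9 0 0 2].

Lemma tau_comoving (x y t : R) :
  tau x y t = comoving 3 2 (poly_jet tau_monomials 0 0 0) x y t.
Proof. unfold tau, comoving; simpl; field. Qed.

Lemma tau_hirota (x y t : R) :
  hirota_KP1 (fun i j => comoving 3 2 (poly_jet tau_monomials i j 0))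
    (fun i j => comoving 3 2 (fun X y t =>
       3 * poly_jet tau_monomials (S i) j 0 X y t
       + poly_jet tau_monomials i j 1 X y t)) x y t = 0.
Proof.
(* The identity holds for independent X, y, t, which keeps the expansion
   short. *)
unfold hirota_KP1, comoving; generalize (x + 3 * t + 2); intros X.
cbv [poly_jet tau_monomials pow_deriv].
rewrite ?INR_IZR_INZ; simpl.
field.
Qed.

(** tau = 9 t^2 + B t + C with B = - 6 X^3 + 72 X y^2 + 33/2; completing the
    square in t leaves C - B^2 / 36, the sum of the remaining terms.  The
    first two squares make up |3 t + 11/4 - z^3|^2 for z = X + 2 i y. *)
Lemma tau_sum_of_squares (x y t : R) :
  let X := x + 3 * t + 2 in
  tau x y t = (3 * t + 11/4 - X ^ 3 + 12 * X * y ^ 2) ^ 2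
    + (6 * X ^ 2 * y - 8 * y ^ 3) ^ 2
    + 9/4 * (X ^ 2 + 4 * y ^ 2) ^ 2 + 9 * y ^ 2 + 9/16.
Proof. unfold tau; cbv zeta; field. Qed.

Lemma tau_pos (x y t : R) : 0 < tau x y t.
Proof.
rewrite tau_sum_of_squares; cbv zeta.
match goal with |- 0 < ?a ^ 2 + ?b ^ 2 + 9/4 * ?c ^ 2 + 9 * y ^ 2 + _ =>
  generalize (pow2_ge_0 a) (pow2_ge_0 b) (pow2_ge_0 c) (pow2_ge_0 y) end.
lra.
Qed.

(* 0 < tau makes ln (tau s y t) a genuine logarithm: ln is total in Stdlib. *)
Theorem theorem4 :
  KP1_solution (KP1_of_tau tauC) /\
  real_solution (KP1_of_tau tauC) /\
  regular_tau tauC /\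
  (forall x y t : R,
     0 < tau x y t /\
     ex_derive_n (fun s => ln (tau s y t)) 2 x /\
     KP1_of_tau tauC x y t
     = RtoC (2 * Derive_n (fun s => ln (tau s y t)) 2 x)).
Proof.
set (T := fun i j => comoving 3 2 (poly_jet tau_monomials i j 0)).
assert (HJ := jets_comoving 3 2 tau_monomials : jets T _).
assert (HT : forall x y t, 0 < T 0%nat 0%nat x y t).
{ intros x y t; unfold T; rewrite <- tau_comoving; apply tau_pos. }
assert (HT0 : forall x y t, T 0%nat 0%nat x y t <> 0).
{ intros x y t; apply Rgt_not_eq, HT. }
assert (Htau : tau = T 0%nat 0%nat).
{ do 3 (apply functional_extensionality; intro); apply tau_comoving. }
assert (Hu := KP1_of_tau_complexify T _ HJ HT0).
change tauC with (complexify tau); rewrite Htau.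
refine (conj _ (conj _ (conj _ (fun x y t => conj (HT x y t) _)))).
- exact (KP1_solution_of_hirota T _ HJ HT0 tau_hirota).
- intros x y t; rewrite Hu; reflexivity.
- intros x y t; unfold KP1_den, complexify; rewrite <- RtoC_mult; intros H.
  apply RtoC_inj, Rmult_integral in H; destruct (HT0 x y t); tauto.
- destruct (second_derivative_ln (fun s => T 0%nat 0%nat s y t)
    (fun s => T 1%nat 0%nat s y t) (T 2%nat 0%nat x y t) x) as [Hex Hd].
  + intros s; apply HT.
  + intros s; apply HJ.
  + apply HJ.
  + split; [exact Hex |].
    rewrite Hd, Hu; unfold complexify, log_xx, ratio.
    f_equal; field; apply HT0.
Qed.
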